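(* Let $S=\{e^{(k)}:k\in\mathbb{N}\}\subseteq\ell_\infty$ and let $F(x)=F_1(x)\cap F_2(x)$ for $x\in[0,1]$. Then for every $x\in(0,1]$ and for every $r>0$ the inclusion $S\subseteq F(x)+B_r$ does not hold. Moreover $S\subseteq F(0)$, and consequently the correspondence $F$ is not H-lsc at $0$.
   Context: $\ell_\infty$ is the normed space of bounded real sequences $t=(t_1,t_2,\dots)$ with the supremum norm, $\mathcal{P}(\ell_\infty)$ is its power set, and $B_r$ is the open ball of radius $r$ centered at zero. For $k\in\mathbb{N}=\{1,2,\dots\}$, $e^{(k)}\in\ell_\infty$ denotes the $k$-th unit vector multiplied by $k$, i.e. the sequence whose $k$-th term is $k$ and whose other terms are $0$. The correspondences $F_1,F_2:[0,1]\to\mathcal{P}(\ell_\infty)$ are defined by $$F_1(x)=\{t\in\ell_\infty: t_1\geq x,\ t_k\leq k-x \text{ for all integers } k\geq 2\},$$ $$F_2(x)=\left\{t\in\ell_\infty: t_1\leq 1-x,\ t_k\leq\min\left\{k(1-t_1-x),\ k+\frac{t_1}{k}-\frac{x}{k}\right\}\text{ for all integers } k\geq 2\right\}.$$ A closed-valued correspondence $G$ from a topological space $Y$ (here $Y=[0,1]$ with the usual topology) into a normed space is Hausdorff-lower semicontinuous (H-lsc) at $y\in Y$ if for every $r>0$ there exists a neighborhood $V$ of $y$ such that $G(y)\subseteq G(y')+B_r$ for all $y'\in V$. *)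

(* Defs.v *)
From HB Require Import structures.
From mathcomp Require Import all_boot all_order all_algebra.
From mathcomp Require Import all_classical all_reals all_analysis.
Set Implicit Arguments.
Unset Strict Implicit.
Unset Printing Implicit Defensive.
Import Order.TTheory GRing.Theory Num.Theory.
Import numFieldNormedType.Exports.
Local Open Scope classical_set_scope.
Local Open Scope ring_scope.

Section linf_pred.
Variable R : realType.

Definition bounded_seq : {pred nat -> R^o} :=
  mem (bounded_fun : set (nat -> R^o)).

Lemma bounded_seqP (u : nat -> R^o) :
  reflect (exists M, forall n, `|u n| <= M) (u \in bounded_seq).
Proof.
apply: (iffP idP) => [/set_mem ub|[M uM]].
  have [M _ uM] := ex_strict_bound_gt0 ub.
  by exists M => n; rewrite ltW//; exact: uM.
apply/mem_set; exists M; split; first exact: num_real.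
by move=> x Mx n _ /=; rewrite (le_trans (uM n))// ltW.
Qed.

Lemma bounded_seq_submod_closed : submod_closed bounded_seq.
Proof.
split; first by apply/bounded_seqP; exists 0 => n; rewrite normr0.
move=> a u v /bounded_seqP[M uM] /bounded_seqP[N vN].
apply/bounded_seqP; exists (`|a| * M + N) => n.
rewrite (le_trans (ler_normD _ _))// lerD// normrM.
by rewrite ler_wpM2l.
Qed.

HB.instance Definition _ := GRing.isSubmodClosed.Build R (nat -> R^o)
  bounded_seq bounded_seq_submod_closed.

Record linf := Linf { linf_val :> nat -> R^o; _ : linf_val \in bounded_seq }.

HB.instance Definition _ := [isSub for linf_val].
HB.instance Definition _ := [Choice of linf by <:].
HB.instance Definition _ := [SubChoice_isSubLmodule of linf by <:].

Definition linf_norm (t : linf) : R := sup (range (fun n => `|t n|)).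

Lemma linf_norm_ub (t : linf) n : `|t n| <= linf_norm t.
Proof.
case: t => t bt; apply: ub_le_sup; last by exists n.
by have /bounded_seqP[M tM] := bt; exists M => _ [m _ <-]; exact: tM.
Qed.

Lemma linf_norm_le (t : linf) M : (forall n, `|t n| <= M) -> linf_norm t <= M.
Proof.
by move=> tM; apply: ge_sup; [exists `|t 0%N|, 0%N|move=> _ [n _ <-]].
Qed.

Lemma linf_normD (s t : linf) : linf_norm (s + t) <= linf_norm s + linf_norm t.
Proof.
apply: linf_norm_le => n.
by rewrite (le_trans (ler_normD _ _))// lerD// linf_norm_ub.
Qed.

Lemma linf_normZ_le (a : R) (t : linf) :
  linf_norm (a *: t) <= `|a| * linf_norm t.
Proof.
by apply: linf_norm_le => n; rewrite normrM ler_wpM2l// linf_norm_ub.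
Qed.

Lemma linf_normZ (a : R) (t : linf) : linf_norm (a *: t) = `|a| * linf_norm t.
Proof.
have ge0 s : 0 <= linf_norm s by rewrite (le_trans _ (linf_norm_ub s 0%N)).
apply/le_anti; rewrite linf_normZ_le/=.
have [->|a0] := eqVneq a 0; first by rewrite normr0 mul0r ge0.
rewrite -ler_pdivlMl ?normr_gt0//.
by have := linf_normZ_le a^-1 (a *: t); rewrite scalerK// normfV.
Qed.

Lemma linf_norm_eq0 (t : linf) : linf_norm t = 0 -> t = 0.
Proof.
move=> t0; apply/val_inj/funext => n /=.
by apply/eqP; rewrite -normr_le0 -t0 linf_norm_ub.
Qed.

HB.instance Definition _ :=
  Lmodule_isNormed.Build R linf linf_normD linf_normZ linf_norm_eq0.

End linf_pred.

(* Sequences are indexed from 1 on paper and from 0 in [linf]: [term t k] is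
   the paper's t_k and is only meaningful for k >= 1. *)
Definition term (R : realType) (t : linf R) (k : nat) : R := t k.-1.

Lemma unit_seq_bounded (R : realType) (k : nat) :
  (fun n => if n.+1 == k then k%:R else 0) \in @bounded_seq R.
Proof.
by apply/bounded_seqP; exists k%:R => n; case: ifP; rewrite ?normr0// ger0_norm.
Qed.

Definition unit_seq (R : realType) (k : nat) : linf R :=
  Linf (@unit_seq_bounded R k).

(* Minkowski sum of A with the open ball of radius r centered at 0 *)
Definition enlarge (R : realType) (V : normedModType R) (A : set V) (r : R) :
    set V :=
  [set a + b | a in A & b in ball (0 : V) r].

(* Lower semicontinuity is only considered for correspondences G with closed
   values; the condition itself does not involve closedness, which [F_closed]
   establishes separately for the correspondence studied here. *)
Definition hlsc_at (R : realType) (Y : topologicalType) (V : normedModType R)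
    (G : Y -> set V) (y : Y) : Prop :=
  forall r : R, 0 < r ->
    exists2 U : set Y, nbhs y U & forall y', U y' -> G y `<=` enlarge (G y') r.

(* [0, 1] with the subspace topology of R, inherited from [set_type] *)
Definition unit_itv (R : realType) : set R := `[0, 1].
Arguments unit_itv R : clear implicits.

Lemma unit_itv0 (R : realType) : 0 \in unit_itv R.
Proof. by apply/mem_set; rewrite /unit_itv/= in_itv/= lexx ler01. Qed.

Definition itv0 (R : realType) : unit_itv R := SigSub (@unit_itv0 R).

Definition F1 (R : realType) (x : unit_itv R) : set (linf R) :=
  [set t | \val x <= term t 1 /\
    forall k : nat, (2 <= k)%N -> term t k <= k%:R - \val x].

Definition F2 (R : realType) (x : unit_itv R) : set (linf R) :=
  [set t | term t 1 <= 1 - \val x /\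
    forall k : nat, (2 <= k)%N ->
      term t k <= Num.min (k%:R * (1 - term t 1 - \val x))
                          (k%:R + term t 1 / k%:R - \val x / k%:R)].

Definition F (R : realType) (x : unit_itv R) : set (linf R) := F1 x `&` F2 x.

Definition unit_seqs (R : realType) : set (linf R) :=
  [set unit_seq R k | k in [set k : nat | (1 <= k)%N]].
Arguments unit_seqs R : clear implicits.

Lemma term_unit_seq (R : realType) (k j : nat) : (1 <= j)%N ->
  term (unit_seq R k) j = if j == k then k%:R else 0.
Proof. by case: j. Qed.

Lemma term_continuous (R : realType) (k : nat) :
  continuous (fun t : linf R => term t k : R^o).
Proof.
move=> t; apply/(@cvgrPdist_lt _ _ _ (nbhs t)) => e e0.
apply: filterS (nbhsx_ballx t e e0) => s; rewrite -ball_normE/=.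
exact/le_lt_trans/(linf_norm_ub (t - s)).
Qed.

Lemma F_closed (R : realType) (x : unit_itv R) : closed (F x).
Proof.
have tc k := @term_continuous R k.
have cle (f g : linf R -> R^o) : continuous f -> continuous g ->
    closed [set t | f t <= g t].
  move=> cf cg.
  rewrite (_ : [set t | _] = (g \- f) @^-1` [set y | 0 <= y]); last first.
    by apply/seteqP; split => t /=; rewrite subr_ge0.
  apply: preimage_closed; last exact: closed_ge.
  by move=> t _; apply: (@cvgB _ _ _ (nbhs t)); [exact: cg|exact: cf].
have cst_c (c : R^o) : continuous (fun _ : linf R => c).
  exact: cst_continuous.
have -> : F x = [set t | \val x <= term t 1] `&` [set t | term t 1 <= 1 - \val x]
    `&` \bigcap_(k in [set k | (2 <= k)%N])
      ([set t | term t k <= k%:R - \val x] `&`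
       [set t | term t k <= k%:R * (1 - term t 1 - \val x)] `&`
       [set t | term t k <= k%:R + term t 1 / k%:R - \val x / k%:R]).
  apply/seteqP; split => t /=.
    move=> [[h1 h2] [h3 h4]]; split => // k /= k2; have := h4 _ k2.
    by rewrite le_min => /andP[? ?]; split => //; split => //=; exact: h2.
  move=> [[h1 h3] h]; split; split => // k k2; have [[/= a b] c] := h _ k2 => //.
  by rewrite le_min b.
apply: closedI; first by apply: closedI; apply: cle => //; exact: tc.
apply: closed_bigI => k _; apply: closedI; first apply: closedI.
- by apply: cle => //; exact: tc.
- apply: cle; first exact: tc.
  move=> t; apply: (@cvgM _ _ (nbhs t)); first exact: cst_c.
  apply: (@cvgB _ _ _ (nbhs t)); last exact: cst_c.
  by apply: (@cvgB _ _ _ (nbhs t)); [exact: cst_c|exact: tc].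
- apply: cle; first exact: tc.
  move=> t; apply: (@cvgB _ _ _ (nbhs t)); last exact: cst_c.
  apply: (@cvgD _ _ _ (nbhs t)); first exact: cst_c.
  by apply: (@cvgM _ _ (nbhs t)); [exact: tc|exact: cst_c].
Qed.

(* Main.v *)
(** On [F x] one has [x <= t_1], hence [t_k <= k (1 - t_1 - x) <= k - 2 k x] for
    [k >= 2]: when [x > 0] the [k]-th coordinate of every point of [F x] stays
    [2 k x] below that of [e^(k)], a gap unbounded in [k].  Failure of H-lsc at
    [0] follows because every neighborhood of [0] in [0, 1] contains some
    [x > 0]. *)
Require Import Defs.
From mathcomp Require Import all_boot all_order all_algebra.
From mathcomp Require Import all_classical all_reals all_analysis.
From mathcomp Require Import lra.
Import Order.TTheory GRing.Theory Num.Theory.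
Import numFieldNormedType.Exports.
Local Open Scope classical_set_scope.
Local Open Scope ring_scope.

Lemma F_term_le {R : realType} {x : unit_itv R} {t : linf R} {k : nat} :
  F x t -> (2 <= k)%N -> term t k <= k%:R - k%:R * (\val x *+ 2).
Proof.
move=> [[t1 _] [_ tk]] k2; have := tk _ k2; rewrite le_min => /andP[+ _].
move=> /le_trans; apply; rewrite -[X in _ <= X - _]mulr1 -mulrBr.
by apply: ler_wpM2l => //; lra.
Qed.

(** Each coordinate is dominated by the sup norm, so adding a point of the ball raises it by less
    than [r]. *)
Lemma enlarge_term_lt {R : realType} {A : set (linf R)} {r : R} {t : linf R}
    {k : nat} :
  enlarge A r t -> exists2 a, A a & term t k < term a k + r.
Proof.
move=> [a Aa [b br <-]]; exists a => //.
rewrite /term /= ltrD2l (le_lt_trans (ler_norm _))//.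
apply: le_lt_trans (linf_norm_ub b k.-1) _.
by move: br; rewrite -ball_normE /= sub0r normrN.
Qed.

Lemma unit_seqs_not_sub_enlarge {R : realType} (x : unit_itv R) (r : R) :
  0 < \val x -> ~ (unit_seqs R `<=` enlarge (F x) r).
Proof.
move=> x0 sub.
(* One successor already exceeds [r / (2 x)], making the gap [2 k x] larger than [r]; the other
   ensures [k >= 2]. *)
pose k := (Num.truncn (r / (\val x *+ 2))).+2.
have rk : r < k%:R * (\val x *+ 2).
  rewrite -ltr_pdivrMr ?mulrn_wgt0// (lt_le_trans (truncnS_gt _))//.
  by rewrite ler_nat.
have ek : unit_seqs R (unit_seq R k) by exists k.
have [a Fa] := enlarge_term_lt (k := k) (sub _ ek).
rewrite term_unit_seq// eqxx.
have := F_term_le (k := k) Fa isT; lra.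
Qed.

Lemma unit_seqs_sub_F0 {R : realType} : unit_seqs R `<=` F (itv0 R).
Proof.
move=> _ [k /= k1 <-]; rewrite /F /F1 /F2 /=.
have term_le j : (1 <= j)%N -> term (unit_seq R k) j <= j%:R.
  by move=> j1; rewrite term_unit_seq//; case: eqP => [->|].
have term_ge0 : 0 <= term (unit_seq R k) 1.
  by rewrite term_unit_seq//; case: ifP.
split; split => //; first by move=> j j2; rewrite subr0; exact/term_le/ltnW.
  by rewrite subr0; exact: (term_le 1%N).
move=> j j2; rewrite mul0r !subr0 le_min; apply/andP; split; last first.
  by rewrite (le_trans (term_le _ (ltnW j2)))// lerDl divr_ge0.
rewrite prednK ?(ltnW j2)//.
(* The bound [j (1 - t_1)] equals [j] if [k <> 1], where [t_1 = 0]; it drops to [0] if [k = 1], but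
   then [t_j = 0] since [j >= 2]. *)
have [k_eq1|k_neq1] := eqVneq 1%N k; last first.
  by rewrite subr0 mulr1; case: eqP => [->|].
by rewrite -k_eq1 subrr mulr0 gtn_eqF.
Qed.

Lemma nbhs_itv0_pos {R : realType} (U : set (unit_itv R)) :
  nbhs (itv0 R) U -> exists2 x, U x & 0 < \val x.
Proof.
rewrite nbhsE => -[_ [[B oB <-] B0] BU].
have /nbhs_ballP[e /= e0 eB] : nbhs (0 : R) B by exact: open_nbhs_nbhs.
(* [e / 2] keeps the point inside the ball of radius [e], and the cap [1] keeps it in the unit
   interval. *)
have m0 : 0 < Num.min (e / 2) 1 by rewrite lt_min divr_gt0/=.
have mI : Num.min (e / 2) 1 \in unit_itv R.
  by apply/mem_set; rewrite /unit_itv /= in_itv /= (ltW m0) ge_min lexx orbT.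
exists (SigSub mI) => //; apply/BU/eB.
rewrite -ball_normE /= sub0r normrN gtr0_norm//.
by rewrite gt_min; apply/orP; left; lra.
Qed.

Theorem proposition3p7 (R : realType) :
  [/\ forall x : unit_itv R, 0 < \val x ->
        forall r : R, 0 < r -> ~ (unit_seqs R `<=` enlarge (F x) r),
      unit_seqs R `<=` F (itv0 R)
    & ~ hlsc_at (@F R) (itv0 R)].
Proof.
split; [by move=> x x0 r _; exact: unit_seqs_not_sub_enlarge| |].
  exact: unit_seqs_sub_F0.
(* Any positive radius would do: the inclusion fails for all of them once [x > 0]. *)
move=> /(_ 1 ltr01)[U /nbhs_itv0_pos[x Ux x0] FU].
apply: (@unit_seqs_not_sub_enlarge _ x 1 x0).
exact: subset_trans unit_seqs_sub_F0 (FU x Ux).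
Qed.
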